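(* Let $s_0,s_1,s_2,\ldots$ be a sequence of real numbers. If the Hankel matrices $S_0^T$, $S_1^T$ satisfy $S^T_0\geqslant S^T_1>0$ for all $T\geqslant2$, then there exists only one Borel measure $\rho$ supported on $(0,1)$ such that $s_k=\int_{-\infty}^\infty\lambda^k\,d\rho(\lambda)$ for all $k=0,1,2,\ldots$. In other words, the Hausdorff moment problem is determinate.
   Context: $S^T_m$ is the $T\times T$ matrix with entries $(S^T_m)_{ij}=s_{2T-i-j+m}$, $i,j=1,\ldots,T$. For symmetric matrices, $X\geqslant Y$ means $X-Y$ is positive semidefinite and $X>0$ means $X$ is positive definite. The Hausdorff moment problem asks for a Borel measure supported on $(0,1)$ with the prescribed moments $s_k$; it is called determinate if it has only one solution.
   Formalization: ''Supported on (0,1)'' is replaced by ''carried by the closed interval [0,1]'', since existence fails on the open interval: s_k = 1/(k+1)+1 satisfies the hypotheses, but its only measure on [0,1] is Lebesgue plus a unit atom at 1. *)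

(* Defs.v *)
From HB Require Import structures.
From mathcomp Require Import all_boot all_order all_algebra.
From mathcomp Require Import all_classical all_reals all_analysis.

Set Implicit Arguments.
Unset Strict Implicit.
Unset Printing Implicit Defensive.

Import Order.TTheory GRing.Theory Num.Theory.
Import numFieldNormedType.Exports.

Local Open Scope classical_set_scope.
Local Open Scope ring_scope.

(* The ordinals i, j stand for the 1-based indices i.+1, j.+1, whose sum is at
   most 2 * T, so the subtractions in nat never truncate. *)
Definition hankel (R : realType) (s : nat -> R) (m T : nat) : 'M[R]_T :=
  \matrix_(i < T, j < T) s (2 * T - i.+1 - j.+1 + m)%N.

Definition possemidef (R : realType) (n : nat) (A : 'M[R]_n) : Prop :=
  A^T = A /\ forall v : 'rV[R]_n, 0 <= (v *m A *m v^T) 0 0.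

Definition posdef (R : realType) (n : nat) (A : 'M[R]_n) : Prop :=
  A^T = A /\ forall v : 'rV[R]_n, v != 0 -> 0 < (v *m A *m v^T) 0 0.

(* The measure must be carried by the closed interval [0, 1]; atoms at the
   endpoints are allowed, since positivity of the Hankel matrices does not
   exclude them.  The integral is extended-real valued and a finite value
   forces integrability, so every solution is a finite measure with finite
   moments. *)
Definition hausdorff_solution (R : realType) (s : nat -> R)
    (rho : {measure set (measurableTypeR R) -> \bar R}) : Prop :=
  rho (~` `[0, 1]) = 0%E /\
  forall k : nat, (\int[rho]_x (x ^+ k)%:E)%E = (s k)%:E.

(* Functions of type {measure set T -> \bar R} are defined on all sets, with
   unspecified values outside the sigma-algebra; measures are therefore
   compared on measurable sets only. *)
Definition hausdorff_determinate (R : realType) (s : nat -> R) : Prop :=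
  exists rho : {measure set (measurableTypeR R) -> \bar R},
    hausdorff_solution s rho /\
    forall rho' : {measure set (measurableTypeR R) -> \bar R},
      hausdorff_solution s rho' ->
      forall A : set (measurableTypeR R), measurable A -> rho' A = rho A.

(* Main.v *)
Require Import Defs.
From HB Require Import structures.
From mathcomp Require Import all_boot all_order all_algebra.
From mathcomp Require Import all_classical all_reals all_analysis.
From mathcomp Require Import measurable_realfun.
From mathcomp Require Import ring lra zify.

(** The Hankel conditions say that the functional [L] sending ['X^k] to [s k]
    is nonnegative on [x q^2] and [(1 - x) q^2] for every polynomial [q], hence
    on every [x^a (1 - x)^b]: when [a + b] is odd this is immediate, and when it
    is even one writes [1 = x + (1 - x)].

    Existence: the weights [C(n, k) L(x^k (1 - x)^(n - k))] at the points
    [k / n] have factorial moments proportional to those of [s], so their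
    moments tend to [s].  An ultrafilter limit [g] of the quantile functions of
    these discrete measures is monotone, and the image of Lebesgue measure on
    [(0, s 0]] by [g] is a solution.

    Uniqueness: the polynomials [(1 - t^(n^2))^m], for suitable [m], converge
    boundedly on [[0, 1]] to the indicator of [[0, x]], so the moments determine
    the mass of [[0, x]]. *)

Set Implicit Arguments.
Unset Strict Implicit.
Unset Printing Implicit Defensive.
Import Order.TTheory GRing.Theory Num.Theory.
Import numFieldNormedType.Exports.
Local Open Scope classical_set_scope.
Local Open Scope ring_scope.

(** * The moment functional and Bernstein weights *)

Section MomentFunctional.
Variables (R : realType) (s : nat -> R).

Definition momentL (p : {poly R}) : R := \sum_(i < size p) p`_i * s i.

Lemma momentL_widen n (p : {poly R}) :
  (size p <= n)%N -> momentL p = \sum_(i < n) p`_i * s i.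
Proof.
move=> pn; rewrite /momentL (big_ord_widen n (fun i => p`_i * s i)) // big_mkcond /=.
by apply: eq_bigr => i _; case: ltnP => // ?; rewrite nth_default ?mul0r.
Qed.

Lemma momentL_is_linear : linear_for *%R momentL.
Proof.
move=> a p q; set n := maxn (size p) (size q).
rewrite (@momentL_widen n p) ?leq_maxl// (@momentL_widen n q) ?leq_maxr//.
rewrite (@momentL_widen n); last first.
  apply: leq_trans (size_polyD _ _) _; rewrite geq_max leq_maxr andbT.
  by apply: leq_trans (size_scale_leq _ _) _; rewrite leq_maxl.
rewrite mulr_sumr -big_split /=; apply: eq_bigr => i _.
by rewrite coefD coefZ mulrDl mulrA.
Qed.

HB.instance Definition _ :=
  GRing.isLinear.Build R {poly R} R *%R momentL momentL_is_linear.

Lemma momentL_Xn k : momentL 'X^k = s k.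
Proof.
rewrite (@momentL_widen k.+1) ?size_polyXn// big_ord_recr /= coefXn eqxx mul1r.
by rewrite big1 ?add0r// => i _; rewrite coefXn ltn_eqF ?mul0r.
Qed.

(** With 0-based indices the Hankel entry is [s ((T - 1 - i) + (T - 1 - j) + m)]: rows and columns
    run through descending powers, so the coefficients of [q] enter in reversed order. *)
Lemma hankel_form m T (q : {poly R}) (v := \row_(i < T) q`_(rev_ord i)) :
  (size q <= T)%N ->
  (v *m hankel s m T *m v^T) 0 0 = momentL ('X^m * q ^+ 2).
Proof.
move=> qT; have qE : q = \sum_(i < T) q`_i *: 'X^i.
  rewrite -poly_def; apply/polyP => i; rewrite coef_poly; case: ltnP => // Ti.
  by rewrite nth_default // (leq_trans qT).
rewrite mxE expr2 {1 2}qE mulr_suml mulr_sumr linear_sum /=.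
rewrite (reindex_inj rev_ord_inj) /=; apply: eq_bigr => j _.
rewrite mxE mulr_suml mulr_sumr mulr_sumr linear_sum /=.
rewrite (reindex_inj rev_ord_inj) /=; apply: eq_bigr => i _.
rewrite !mxE !rev_ordK.
have -> : 'X^m * (q`_j *: 'X^j * (q`_i *: 'X^i))
    = (q`_i * q`_j) *: 'X^(m + j + i) :> {poly R}.
  by rewrite !exprD -!mul_polyC polyCM; ring.
rewrite linearZ /= momentL_Xn mulrAC; congr (_ * s _).
by have := ltn_ord i; have := ltn_ord j; rewrite /=; lia.
Qed.

Hypothesis hS : forall T : nat, (2 <= T)%N ->
  possemidef (hankel s 0 T - hankel s 1 T) /\ posdef (hankel s 1 T).

Lemma momentL_X_sqr_ge0 (q : {poly R}) : 0 <= momentL ('X * q ^+ 2).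
Proof.
(* The size [(size q).+2] holds all coefficients of [q] and is at least 2, as [hS] demands. *)
have [_ [_ pos]] := @hS (size q).+2 isT.
have /(hankel_form 1) := leqW (leqnSn (size q)); rewrite expr1 => <-.
set v := (\row_i _); have [->|/pos/ltW//] := eqVneq v 0.
by rewrite !mul0mx mxE.
Qed.

Lemma momentL_1subX_sqr_ge0 (q : {poly R}) :
  0 <= momentL ((1 - 'X) * q ^+ 2).
Proof.
have [[_ pos] _] := @hS (size q).+2 isT.
have qT := leqW (leqnSn (size q)).
have e0 := hankel_form 0 qT; have e1 := hankel_form 1 qT.
rewrite expr0 in e0; rewrite expr1 in e1.
rewrite mulrBl linearB /= -e0 -e1.
have := pos (\row_i q`_(rev_ord i)); rewrite mulmxBr mulmxBl.
by rewrite [X in 0 <= X -> _]mxE [X in 0 <= _ + X -> _]mxE.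
Qed.

Lemma momentL_bernstein_ge0 a b :
  0 <= momentL ('X^a * (1 - 'X) ^+ b).
Proof.
(* When the total is odd, exactly one exponent is odd; splitting off one factor ['X] or [1 - 'X]
   leaves a square. *)
have odd_ge0 c d : odd (c + d) -> 0 <= momentL ('X^c * (1 - 'X) ^+ d).
  rewrite oddD; case: (boolP (odd c)) => oc; case: (boolP (odd d)) => od //= _.
    rewrite -(odd_double_half c) -(odd_double_half d) oc (negbTE od) add0n add1n.
    by rewrite exprS -!muln2 !exprM -mulrA -exprMn momentL_X_sqr_ge0.
  rewrite -(odd_double_half c) -(odd_double_half d) od (negbTE oc) add0n add1n.
  by rewrite exprS -!muln2 !exprM mulrCA -exprMn momentL_1subX_sqr_ge0.
case: (boolP (odd (a + b))) => [/odd_ge0//|ab].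
have -> : ('X^a * (1 - 'X) ^+ b : {poly R})
    = 'X^(a.+1) * (1 - 'X) ^+ b + 'X^a * (1 - 'X) ^+ b.+1.
  by rewrite !exprS; ring.
by rewrite linearD addr_ge0//= odd_ge0// ?addnS ?addSn.
Qed.

(** The mass placed at [k / n]. For [k > n] the binomial coefficient is 0, so the truncated [n - k]
    does no harm. *)
Definition bernstein_weight n k : R :=
  'C(n, k)%:R * momentL ('X^k * (1 - 'X) ^+ (n - k)).

Lemma bernstein_weight_ge0 n k : 0 <= bernstein_weight n k.
Proof. by rewrite mulr_ge0// momentL_bernstein_ge0. Qed.

End MomentFunctional.

(** * Factorial moments of the Bernstein weights *)

Section FactorialMoments.
Variable (R : realType).

(** Multiplied by [i]! and [(m - i)]!, both sides become [(j + m)]!. *)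
Lemma bin_ffact_shift j m i : (i <= m)%N ->
  ('C(j + m, j + i) * (j + i) ^_ j = (j + m) ^_ j * 'C(m, i))%N.
Proof.
move=> im; apply/eqP; rewrite -(eqn_pmul2r (fact_gt0 i)).
rewrite -(eqn_pmul2r (fact_gt0 (m - i))); apply/eqP.
have ei := @ffact_fact (j + i) j (leq_addr _ _).
have em := @ffact_fact (j + m) j (leq_addr _ _).
rewrite addKn in ei; rewrite addKn in em.
have jim : (j + i <= j + m)%N by rewrite leq_add2l.
rewrite -(mulnA 'C(_, _)) ei -[RHS]mulnA -[RHS]mulnA bin_fact// em.
by rewrite -(bin_fact jim) subnDl mulnA.
Qed.

(** Terms with [k < j] vanish. After the shift [k = j + i] the factor [(j + m) ^_ j] times ['X^j]
    comes out, and what remains is the binomial expansion of [((1 - 'X) + 'X) ^+ m], which is 1. *)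
Lemma bernstein_ffact n j : (j <= n)%N ->
  \sum_(k < n.+1) ('C(n, k) * k ^_ j)%:R *: ('X^k * (1 - 'X) ^+ (n - k))
    = (n ^_ j)%:R *: 'X^j :> {poly R}.
Proof.
move=> /subnKC <-; set m := (n - j)%N; rewrite -addnS big_split_ord /=.
rewrite big1 ?add0r => [|k _]; last by rewrite ffact_small// muln0 scale0r.
transitivity (\sum_(i < m.+1) ((j + m) ^_ j)%:R *: ('X^j *
    ((1 - 'X) ^+ (m - i) * 'X^i *+ 'C(m, i))) : {poly R}).
  apply: eq_bigr => i _; rewrite bin_ffact_shift ?leq_ord// natrM -scalerA.
  rewrite subnDl exprD [X in _ *: X]scaler_nat mulrnAr -mulrA.
  by rewrite (mulrC 'X^i).
rewrite -scaler_sumr -mulr_sumr -exprDn subrK expr1n mulr1//.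
Qed.

Variable (s : nat -> R).
Lemma bernstein_weight_ffact n j : (j <= n)%N ->
  \sum_(k < n.+1) bernstein_weight s n k * (k ^_ j)%:R = (n ^_ j)%:R * s j.
Proof.
move=> jn; transitivity (momentL s ((n ^_ j)%:R *: 'X^j)); last first.
  by rewrite linearZ /= momentL_Xn.
rewrite -bernstein_ffact// linear_sum /=.
by apply: eq_bigr => k _; rewrite linearZ/= natrM /bernstein_weight mulrAC.
Qed.

(** Induction on [j]: the next factors are [k / n] and [(k - j) / (n - j)], which differ by at most
    [j / n]. Since [a] and [b] lie in [0, 1], the errors just add up, and [j ^ 2 + j] is at most
    [j.+1 ^ 2]. *)
Lemma ffact_ratio_close n k j : (k <= n)%N -> (j <= n)%N -> (0 < n)%N ->
  `|(k%:R / n%:R) ^+ j - (k ^_ j)%:R / (n ^_ j)%:R| <= (j ^ 2)%:R / n%:R :> R.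
Proof.
move=> kn jn n0; have n0R : 0 < n%:R :> R by rewrite ltr0n.
elim: j jn => [|j IH] jn; first by rewrite !ffactn0 divr1 expr0 subrr normr0 mul0r.
have {IH} := IH (ltnW jn).
set a := k%:R / n%:R; set b := (k ^_ j)%:R / (n ^_ j)%:R => IH.
have nj0 : 0 < (n ^_ j)%:R :> R by rewrite ltr0n ffact_gt0 ltnW.
have /andP[b0 b1] : 0 <= b <= 1.
  rewrite divr_ge0 ?ler0n//= ler_pdivrMr// mul1r ler_nat.
  by rewrite -!bin_ffact leq_mul2r leq_bin2l ?orbT.
have /andP[a0 a1] : 0 <= a <= 1.
  by rewrite divr_ge0 ?ler0n//= ler_pdivrMr// mul1r ler_nat.
have njR : 0 < (n - j)%:R :> R by rewrite ltr0n subn_gt0.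
pose r : R := (k - j)%:R / (n - j)%:R.
have ar : `|a - r| <= j%:R / n%:R.
  (* For [k <= j] the truncated [k - j] makes [r] zero and [a] is at most [j / n]; otherwise [a - r]
     is [j / n] times a ratio at most 1. *)
  rewrite /a /r; have [kj|jk] := leqP k j.
    rewrite (eqP kj) mul0r subr0 ger0_norm ?divr_ge0//.
    by rewrite ler_pM2r ?invr_gt0// ler_nat.
  have -> : k%:R / n%:R - (k - j)%:R / (n - j)%:R =
      j%:R / n%:R * ((n - k)%:R / (n - j)%:R) :> R.
    rewrite !natrB ?(ltnW jn)// 1?ltnW//; field.
    by rewrite -natrB ?(ltnW jn)// !gt_eqF.
  rewrite ger0_norm ?mulr_ge0 ?invr_ge0//.
  rewrite ler_piMr ?divr_ge0// ler_pdivrMr// mul1r ler_nat.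
  by rewrite leq_sub2l// ltnW.
have -> : (k ^_ j.+1)%:R / (n ^_ j.+1)%:R = b * r :> R.
  by rewrite !ffactnSr !natrM invfM /b /r; ring.
have -> : a ^+ j.+1 - b * r = (a ^+ j - b) * a + b * (a - r).
  by rewrite exprSr; ring.
apply: le_trans (ler_normD _ _) _; rewrite (normrM _ a) (normrM b) (ger0_norm a0) (ger0_norm b0).
have h1 : `|a ^+ j - b| * a <= (j ^ 2)%:R / n%:R by rewrite (le_trans _ IH)// ler_piMr.
have h2 : b * `|a - r| <= j%:R / n%:R by rewrite (le_trans _ ar)// ler_piMl.
apply: le_trans (lerD h1 h2) _; rewrite -mulrDl ler_pM2r ?invr_gt0// -natrD ler_nat.
by lia.
Qed.

End FactorialMoments.

(** * Uniqueness *)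

Section Uniqueness.
Variables (R : realType).

Lemma bernoulli_ineq n (z : R) : -1 <= z -> 1 + n%:R * z <= (1 + z) ^+ n.
Proof.
move=> z1; elim: n => [|n IH]; first by rewrite mul0r addr0 expr0.
rewrite exprS; apply: le_trans (ler_wpM2l _ IH).
  rewrite -subr_ge0 -natr1.
  have -> : (1 + z) * (1 + n%:R * z) - (1 + (n%:R + 1) * z) = n%:R * z ^+ 2 by ring.
  by rewrite mulr_ge0// sqr_ge0.
by rewrite addrC -lerBlDr sub0r.
Qed.

(** Bernoulli at [- y] gives the lower bound; the upper one combines
    [(1 - y) ^+ m * (1 + y) ^+ m <= 1] with Bernoulli at [y]. So the power is near 1 when [m * y] is
    small and near 0 when it is large. *)
Lemma one_sub_expr_bounds (y : R) m : 0 <= y <= 1 ->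
  1 - m%:R * y <= (1 - y) ^+ m <= (1 + m%:R * y)^-1.
Proof.
move=> /andP[y0 y1].
have my0 : 0 <= m%:R * y by rewrite mulr_ge0.
apply/andP; split.
  by have := @bernoulli_ineq m (- y); rewrite mulrN; apply; rewrite lerN2.
rewrite -[leRHS]div1r ler_pdivlMr ?ltr_pwDl//.
apply: (@le_trans _ _ ((1 - y) ^+ m * (1 + y) ^+ m)).
  rewrite ler_wpM2l ?exprn_ge0 ?subr_ge0// bernoulli_ineq//.
  by rewrite (le_trans _ y0)// lerN10.
rewrite -exprMn exprn_ile1//; last by nra.
by rewrite mulr_ge0// ?subr_ge0// addr_ge0.
Qed.

Lemma invn_cvg0 : (n%:R : R)^-1 @[n --> \oo] --> 0.
Proof. by rewrite -(cvg_shiftS (fun n => (n%:R : R)^-1)); exact: cvg_harmonic. Qed.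

(* With [m := cutoff_exponent x n], the product [m * t ^+ (n * n)] tends to [0]
   for [t <= x] and to infinity for [x < t]; this makes [cutoff x n] tend to
   the indicator of [t <= x], including at the jump [t = x]. *)
Definition cutoff_exponent (x : R) n : nat := Num.truncn (x ^- (n * n) / n%:R).

(** At [x = 0] the exponent would be 0, the inverse of 0 being 0; there [(1 - 'X) ^+ n] isolates the
    point 0 instead. *)
Definition cutoff (x : R) n : {poly R} :=
  if x == 0 then (1 - 'X) ^+ n else (1 - 'X^(n * n)) ^+ cutoff_exponent x n.

Lemma cutoff_01 x n (t : R) : 0 <= t <= 1 -> 0 <= (cutoff x n).[t] <= 1.
Proof.
move=> /andP[t0 t1]; rewrite /cutoff; case: ifP => _.
  by rewrite !hornerE exprn_ge0 ?exprn_ile1 ?subr_ge0 ?gerBl.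
have tn : 0 <= t ^+ (n * n) <= 1 by rewrite exprn_ge0//= exprn_ile1.
by rewrite !hornerE exprn_ge0 ?exprn_ile1 ?subr_ge0 ?gerBl; case/andP: tn.
Qed.

Lemma cutoff_cvg x (t : R) : 0 <= x -> 0 <= t <= 1 ->
  (cutoff x n).[t] @[n --> \oo] --> (\1_(`]-oo, x]%classic) t : R).
Proof.
move=> x0 /andP[t0 t1]; rewrite indicE mem_setE in_itv /= /cutoff.
have [->|xn0] := eqVneq x 0.
  under eq_fun do rewrite !hornerE.
  have [->|tn0] := eqVneq t 0.
    by rewrite lexx subr0; under eq_fun do rewrite expr1n; exact: cvg_cst.
  rewrite leNgt lt_neqAle eq_sym tn0 t0 /=; apply: cvg_expr.
  by rewrite ger0_norm ?subr_ge0// ltrBlDr ltrDl lt_neqAle eq_sym tn0.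
have {}x0 : 0 < x by rewrite lt_neqAle eq_sym xn0.
under eq_fun do rewrite !hornerE.
pose m n := cutoff_exponent x n.
have mle n : (m n)%:R <= x ^- (n * n) / n%:R.
  by rewrite truncn_le // divr_ge0// invr_ge0 exprn_ge0// ltW.
have mge n : x ^- (n * n) / n%:R - 1 <= (m n)%:R.
  by rewrite lerBlDr natr1 ltW// truncnS_gt.
have tn n : 0 <= t ^+ (n * n) <= 1 by rewrite exprn_ge0//= exprn_ile1.
have [tx|xt] := leP t x.
  (* For [t <= x], [m n * t ^+ (n * n)] is at most [(t / x) ^+ (n * n) / n], hence at most [1 / n],
     even at [t = x]. *)
  apply: (@squeeze_cvgr _ _ _ _ (fun n => 1 - n%:R^-1) (cst 1)).
  - near=> n; have /andP[lb _] := one_sub_expr_bounds (m n) (tn n).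
    rewrite exprn_ile1 ?subr_ge0 ?gerBl ?andbT; [|by case/andP: (tn n)..].
    apply: le_trans lb; rewrite lerD2l lerN2.
    apply: le_trans (ler_wpM2r _ (mle n)) _; first by case/andP: (tn n).
    rewrite mulrAC ler_piMl// mulrC ler_pdivrMr ?exprn_gt0// mul1r.
    by rewrite lerXn2r// nnegrE ltW.
  - rewrite -[X in _ --> X]subr0; apply: cvgB; first exact: cvg_cst.
    exact: invn_cvg0.
  - exact: cvg_cst.
(* Bernoulli gives [(t / x) ^+ (n * n) >= 1 + n * n * d]. After division by [n] and the loss of at
   most 1 from truncation, [1 + m n * t ^+ (n * n)] is still at least [n * d]. *)
pose d := t / x - 1.
have d0 : 0 < d by rewrite subr_gt0 ltr_pdivlMr// mul1r.
apply: (@squeeze_cvgr _ _ _ _ (cst 0) (fun n => d^-1 * n%:R^-1)).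
- near=> n; have n0 : 0 < n%:R :> R by rewrite ltr0n; near: n; exact: nbhs_infty_gt.
  have /andP[_ ub] := one_sub_expr_bounds (m n) (tn n).
  rewrite /cst exprn_ge0 ?subr_ge0/=; last by case/andP: (tn n).
  apply: (le_trans ub); rewrite -invfM mulrC lef_pV2 ?posrE; last first.
  + by rewrite mulr_gt0.
  + by rewrite ltr_pwDl// mulr_ge0//; case/andP: (tn n).
  have : (x ^- (n * n) / n%:R - 1) * t ^+ (n * n) <= (m n)%:R * t ^+ (n * n).
    by rewrite ler_wpM2r//; case/andP: (tn n).
  have : 1 + (n * n)%:R * d <= (t / x) ^+ (n * n).
    rewrite -[t / x](subrK 1) -/d (addrC d) bernoulli_ineq//.
    by rewrite (le_trans _ (ltW d0))// lerN10.
  rewrite expr_div_n natrM mulrBl mul1r => h1 h2.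
  have : n%:R * d <= x ^- (n * n) / n%:R * t ^+ (n * n).
    rewrite mulrAC ler_pdivlMr// [X in _ <= X]mulrC; lra.
  by have /andP[_ ?] := tn n; lra.
- exact: cvg_cst.
- rewrite -[X in _ --> X](mulr0 d^-1); apply: cvgMr; exact: invn_cvg0.
Unshelve. all: by end_near.
Qed.

(** * Integrals against a solution of the moment problem *)

Section Solutions.
Variables (s : nat -> R) (rho : {measure set (measurableTypeR R) -> \bar R}).
Hypothesis rho_s : hausdorff_solution s rho.

Let D : set (measurableTypeR R) := `[0, 1].
Let mD : measurable D. Proof. exact: measurable_itv. Qed.

Lemma hausdorff_solution_setT : rho setT = (s 0)%:E.
Proof.
have [_ /(_ 0%N) <-] := rho_s; under eq_integral do rewrite expr0.
by rewrite -[RHS]/(\int[rho]_(x in setT) (cst 1%:E) x)%E integral_cst// mul1e.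
Qed.

Let rhoD_fin : (rho D < +oo)%E.
Proof.
apply: (@le_lt_trans _ _ (rho setT)); first by rewrite le_measure ?inE.
by rewrite hausdorff_solution_setT ltry.
Qed.

Lemma hausdorff_solution_integrable (f : measurableTypeR R -> R) :
  measurable_fun D f -> [bounded f x | x in D] -> rho.-integrable D (EFin \o f).
Proof. exact: measurable_bounded_integrable. Qed.

Lemma hausdorff_solution_expr k : (\int[rho]_(x in D) (x ^+ k)%:E)%E = (s k)%:E.
Proof.
have [rhoD /(_ k) <-] := rho_s; rewrite integral_mkcond.
have mk : @measurable_fun _ _ (measurableTypeR R) (\bar R) setT
    (fun x : R => (x ^+ k)%:E).
  by apply/measurable_EFinP; exact: exprn_measurable.
apply: ae_eq_integral => //.
  by apply/(measurable_restrictT _ _).1 => //; exact: measurable_funTS.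
exists (~` D); split => //; first exact: measurableC.
by move=> x /= nx Dx; apply: nx => _; rewrite patchE mem_set.
Qed.

Lemma hausdorff_solution_horner (p : {poly R}) :
  (\int[rho]_(x in D) (p.[x])%:E)%E = (momentL s p)%:E.
Proof.
have int_expr k : rho.-integrable D (EFin \o (fun x : R => x ^+ k)).
  apply: hausdorff_solution_integrable; first exact: exprn_measurable.
  exists 1; split; first exact: num_real.
  move=> M M1 x; rewrite /D /= in_itv /= => /andP[x0 x1].
  by rewrite normrX ger0_norm// (le_trans _ (ltW M1))// exprn_ile1.
under eq_integral.
  move=> x _; rewrite horner_coef -sumEFin.
  under eq_bigr do rewrite EFinM.
  over.
rewrite integral_sum//=; last by move=> i; exact: (integrableZl mD _ (int_expr i)).
rewrite /momentL -sumEFin; apply: eq_bigr => i _.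
by rewrite (integralZl mD (int_expr i)) hausdorff_solution_expr EFinM.
Qed.

(** Dominated convergence on [0, 1] with the constant bound 1. The sequence on the left depends on
    [s] alone, so the mass of the ray is the same for all solutions. *)
Lemma cvg_moments_cutoff x : 0 <= x ->
  (momentL s (cutoff x n))%:E @[n --> \oo] --> rho `]-oo, x]%classic.
Proof.
move=> x0; have [rhoD _] := rho_s.
have mI : measurable (`]-oo, x]%classic : set (measurableTypeR R)) by exact: measurable_itv.
have -> : rho `]-oo, x]%classic = (\int[rho]_(t in D) (\1_(`]-oo, x]%classic) t)%:E)%E.
  rewrite integral_indic//; apply/eqP; rewrite eq_le; apply/andP; split; last first.
    by rewrite le_measure ?inE//; exact: measurableI.
  have D0 : rho (`]-oo, x]%classic `\` D) = 0%E.
    apply: (subset_measure0 _ _ _ rhoD); last by move=> t [].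
    - exact: measurableD.
    - exact: measurableC.
  have -> : rho `]-oo, x]%classic = (0 + rho (`]-oo, x]%classic `&` D))%E.
    by rewrite -D0; exact: measureDI.
  by rewrite add0e.
have -> : (fun n => (momentL s (cutoff x n))%:E) =
    (fun n => \int[rho]_(t in D) ((cutoff x n).[t])%:E)%E.
  by apply/funext => n; rewrite hausdorff_solution_horner.
pose f_ n (t : measurableTypeR R) := ((cutoff x n).[t])%:E.
pose f (t : measurableTypeR R) := (\1_(`]-oo, x]%classic) t : R)%:E.
have mf_ n : measurable_fun D (f_ n).
  by apply/measurable_EFinP; exact: measurable_poly.
have mf : measurable_fun D f by apply/measurable_EFinP; exact: measurable_indic.
have f_f : {ae rho, forall t, D t -> f_ n t @[n --> \oo] --> f t}.
  apply: aeW => t; rewrite /D /= in_itv /= => t01.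
  by apply: cvg_EFin; [exact: nearW|exact: cutoff_cvg].
have i1 : rho.-integrable D (EFin \o cst 1).
  apply: hausdorff_solution_integrable => //.
  by exists 1; split=> // M M1 t _ /=; rewrite normr1 ltW.
have f_1 : {ae rho, forall t n, D t -> (`|f_ n t| <= 1%:E)%E}.
  apply: aeW => t n; rewrite /D /= in_itv /= => t01.
  by have /andP[c0 c1] := cutoff_01 x n t01; rewrite lee_fin ger0_norm.
by have [_ _] := dominated_convergence mD mf_ mf f_f i1 f_1.
Qed.

End Solutions.

(** Closed left rays have equal mass: by the cutoffs for [0 <= x], and because both masses vanish
    for [x < 0]. Complements carry this over to open right rays, an intersection-stable family
    generating the Borel sets. *)
Lemma moments_determine (s : nat -> R)
    (rho rho' : {measure set (measurableTypeR R) -> \bar R}) :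
  hausdorff_solution s rho -> hausdorff_solution s rho' ->
  forall A : set (measurableTypeR R), measurable A -> rho' A = rho A.
Proof.
move=> rs rs'.
have ray x : rho' `]-oo, x]%classic = rho `]-oo, x]%classic.
  have [x0|x0] := leP 0 x.
    have c := cvg_moments_cutoff rs x0; have c' := cvg_moments_cutoff rs' x0.
    exact: (cvg_unique _ c' c).
  have mI : measurable (`]-oo, x]%classic : set (measurableTypeR R)) by exact: measurable_itv.
  have neg (r : {measure set (measurableTypeR R) -> \bar R}) :
      hausdorff_solution s r -> r `]-oo, x]%classic = 0%E.
    move=> [r0 _]; apply: (subset_measure0 _ _ _ r0) => //.
      by apply: measurableC; exact: measurable_itv.
    move=> t /=; rewrite !in_itv /= => tx /andP[t0 _].
    by have := le_lt_trans (le_trans t0 tx) x0; rewrite ltxx.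
  by rewrite !neg.
have rayC x : rho' `]x, +oo[%classic = rho `]x, +oo[%classic.
  have mI : measurable (`]-oo, x]%classic : set (measurableTypeR R)) by exact: measurable_itv.
  have compl (r : {measure set (measurableTypeR R) -> \bar R}) :
      hausdorff_solution s r ->
      r (~` `]-oo, x]%classic) = ((s 0%N)%:E - r `]-oo, x]%classic)%E.
    move=> /hausdorff_solution_setT rT; rewrite -rT -[X in (_ - r X)%E]setTI -setTD.
    by apply: measureD => //; rewrite [X in (X < _)%E]rT ltry.
  by rewrite -setCitvl !compl// ray.
(* The rays above [- n] exhaust the line and have finite mass. *)
apply: (@measure_unique _ R (measurableTypeR R) (RGenOInfty.G (R:=R))
  (fun n => `](- n%:R : R), +oo[%classic)).
- exact: RGenOInfty.measurableE.
- move=> _ _ [x ->] [y ->]; exists (Num.max x y).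
  by apply/seteqP; split => t /=; rewrite !in_itv /= !andbT gt_max => /andP.
- by move=> n; exists (- n%:R).
- apply/seteqP; split => // t _; exists (Num.truncn `|t|).+1 => //=.
  by rewrite in_itv /= andbT ltrNl (le_lt_trans (ler_norm _))// normrN truncnS_gt.
- by move=> _ [x ->]; exact: rayC.
- move=> n; apply: (@le_lt_trans _ _ (rho' setT)).
    by rewrite le_measure ?inE//; exact: measurable_itv.
  by rewrite (hausdorff_solution_setT rs') ltry.
Qed.
End Uniqueness.

(** * Quantile functions and existence *)

Section MonotoneIntegrals.
Variable R : realType.
Local Notation mu := (@lebesgue_measure R).
Local Notation itv a b := (`]a%R, b%R]%classic : set (measurableTypeR R)).

Lemma lebesgue_itv_oc (a b : R) : a <= b -> mu (itv a b) = (b - a)%:E.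
Proof.
rewrite lebesgue_measure_itv /= lte_fin le_eqVlt => /predU1P[->|->//].
by rewrite ltxx subrr.
Qed.

Lemma integral_itv_cst (a b c : R) : a <= b ->
  (\int[mu]_(x in itv a b) c%:E = (c * (b - a))%:E)%E.
Proof.
move=> ab; rewrite EFinM -(lebesgue_itv_oc ab).
exact: integral_cst (measurable_itv `]a, b] : measurable (itv a b)) _.
Qed.

(** On each cell of length [d] the function lies between its values at the two endpoints; the cells
    are added one at a time. *)
Lemma monotone_riemann_sum (h : R -> R) (d : R) n :
  {homo h : x y / x <= y} -> (forall x, 0 <= h x) -> 0 <= d ->
  ((d * \sum_(i < n) h (i%:R * d))%:E
     <= \int[mu]_(x in itv 0 (n%:R * d)%R) (h x)%:E
     <= (d * \sum_(i < n) h (i.+1%:R * d))%:E)%E.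
Proof.
move=> hm h0 d0; have mh D : measurable_fun (D : set (measurableTypeR R)) (EFin \o h).
  apply/measurable_EFinP; apply: (measurable_funS measurableT) => //.
  exact: nondecreasing_measurable.
elim: n => [|n /andP[IHl IHu]].
  by rewrite !big_ord0 mulr0 mul0r set_itvoc0 integral_set0 lexx.
have step : n%:R * d <= n.+1%:R * d by rewrite ler_wpM2r// ler_nat.
have -> : itv 0 (n.+1%:R * d) = itv 0 (n%:R * d) `|` itv (n%:R * d) (n.+1%:R * d).
  by rewrite -itv_bndbnd_setU// bnd_simp ?mulr_ge0.
have disj : [disjoint itv 0 (n%:R * d) & itv (n%:R * d) (n.+1%:R * d)].
  apply/disj_set2P/seteqP; split => // x [] /=; rewrite !in_itv /=.
  by move=> /andP[_ x1] /andP[x2 _]; have := le_lt_trans x1 x2; rewrite ltxx.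
rewrite (ge0_integral_setU mu _ _ (mh _))//; last by move=> x _; rewrite lee_fin.
rewrite !big_ord_recr /= !mulrDr !EFinD.
have dE : n.+1%:R * d - n%:R * d = d by rewrite -natr1; ring.
have cstE c : (\int[mu]_(x in itv (n%:R * d) (n.+1%:R * d)) c%:E)%E = (d * c)%:E.
  by rewrite integral_itv_cst// dE mulrC.
apply/andP; split; apply: leeD => //; rewrite -cstE.
  apply: ge0_le_integral => //; first by move=> *; rewrite lee_fin.
  by move=> x /=; rewrite in_itv /= lee_fin => /andP[/ltW nx _]; exact: hm.
apply: ge0_le_integral => //; first by move=> *; rewrite lee_fin.
by move=> x /=; rewrite in_itv /= lee_fin => /andP[_ xn]; exact: hm.
Qed.

(** Summation by parts, written with the tails [W n - W k] because these are the lengths of the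
    intervals on which a quantile function exceeds level [k]. *)
Lemma abel_sum (w a : nat -> R) n (W := fun k => \sum_(i < k.+1) w i) :
  \sum_(k < n.+1) w k * a k =
  a 0%N * W n + \sum_(k < n) (a k.+1 - a k) * (W n - W k).
Proof.
elim: n => [|n IH]; first by rewrite big_ord0 addr0 /W !big_ord1 mulrC.
rewrite big_ord_recr /= IH [in RHS]big_ord_recr /=.
have WS k : W k.+1 = W k + w k.+1 by rewrite /W big_ord_recr.
rewrite WS; have -> : \sum_(i < n) (a i.+1 - a i) * (W n + w n.+1 - W i) =
    \sum_(i < n) (a i.+1 - a i) * (W n - W i) + w n.+1 * (a n - a 0%N).
  rewrite -(telescope_sumr a (leq0n n)) big_mkord mulr_sumr -big_split /=.
  by apply: eq_bigr => i _; ring.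
by ring.
Qed.

(** A downward closed [P] holds exactly on an initial segment, whose length is the count, so the
    selected increments telescope. *)
Lemma telescope_count (P : pred nat) (a : nat -> R) n :
  (forall k, P k.+1 -> P k) ->
  a (\sum_(k < n) P k)%N = a 0%N + \sum_(k < n) (a k.+1 - a k) * (P k)%:R.
Proof.
move=> Pd; elim: n => [|n IH]; first by rewrite !big_ord0 addr0.
rewrite !big_ord_recr /=; case: (boolP (P n)) => Pn; last first.
  by rewrite addn0 IH mulr0 addr0.
have Pk k : (k <= n)%N -> P k.
  elim: n Pn {IH} => [|n IHn] Pn; first by rewrite leqn0 => /eqP ->.
  by rewrite leq_eqVlt => /predU1P[->//|]; rewrite ltnS; apply: IHn; exact: Pd.
have e m : (m <= n)%N -> (\sum_(k < m) P k)%N = m.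
  move=> mn; rewrite -[RHS]muln1 -[m in RHS]card_ord -sum_nat_const.
  by apply: eq_bigr => k _; rewrite Pk// (leq_trans _ mn)// ltnW.
by rewrite addrA -IH e// addn1 mulr1 addrC subrK.
Qed.

(** For nonnegative [w] and [u] in (0, [W n]], where [W k] is the sum of [w i] over [i <= k], this
    is the least [k / n] with [u <= W k]: the left-continuous inverse of the distribution function
    of the masses [w k] at [k / n]. *)
Definition quantile (w : nat -> R) n (u : R) : R :=
  (\sum_(k < n) (\sum_(i < k.+1) w i < u)%R)%:R / n%:R.

Lemma quantile_nondecreasing w n : {homo quantile w n : u v / u <= v}.
Proof.
move=> u v uv; rewrite ler_wpM2r ?invr_ge0// ler_nat; apply: leq_sum => k _.
by case: ltP => //= ku; rewrite (lt_le_trans ku uv).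
Qed.

Lemma quantile_01 w n u : 0 <= quantile w n u <= 1.
Proof.
rewrite /quantile divr_ge0//=; case: n => [|n]; first by rewrite big_ord0 mul0r.
rewrite ler_pdivrMr ?ltr0n// mul1r ler_nat -[leqRHS]card_ord -sum1_card.
by apply: leq_sum => k _; exact: leq_b1.
Qed.

(** The [j]-th power of the quantile function is a step function jumping by [a k.+1 - a k] just
    after [W k]. Each jump contributes its height times [W n - W k], and [abel_sum] recovers the
    weighted sum. *)
Lemma integral_quantile_expr (w : nat -> R) n j : (forall k, 0 <= w k) ->
  (\int[mu]_(u in itv 0 (\sum_(k < n.+1) w k)%R) (quantile w n u ^+ j)%:E =
    (\sum_(k < n.+1) w k * (k%:R / n%:R) ^+ j)%:E)%E.
Proof.
move=> w0; pose W k := \sum_(i < k.+1) w i; pose a k : R := (k%:R / n%:R) ^+ j.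
have WS k : W k.+1 = W k + w k.+1 by rewrite /W big_ord_recr.
have Wm : {homo W : k l / (k <= l)%N >-> k <= l}.
  by apply: homo_leq => // [?|k]; rewrite ?lexx// ?WS ?lerDl//; exact: le_trans.
have W0 k : 0 <= W k by rewrite sumr_ge0.
have am k : 0 <= a k.+1 - a k.
  rewrite subr_ge0 lerXn2r ?nnegrE ?divr_ge0//.
  by rewrite ler_wpM2r ?invr_ge0// ler_nat.
rewrite -/(W n) (abel_sum w a n) -/(W n).
pose f k (u : measurableTypeR R) := ((a k.+1 - a k) * \1_(`]W k, +oo[%classic) u)%:E.
have mf (D : set (measurableTypeR R)) k : measurable D -> measurable_fun D (f k).
  by move=> mD; apply/measurable_EFinP; apply: measurable_funM => //; exact: measurable_indic.
transitivity (\int[mu]_(u in itv 0 (W n)) ((a 0%N)%:E + \sum_(k < n) f k u))%E.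
  apply: eq_integral => u _.
  have -> : quantile w n u ^+ j = a (\sum_(k < n) (W k < u)%R)%N by [].
  rewrite (telescope_count (P := fun k => W k < u)); last first.
    by move=> k; apply: le_lt_trans; rewrite WS lerDl.
  rewrite EFinD -sumEFin; congr (_ + _)%E; apply: eq_bigr => k _.
  by rewrite /f indicE mem_setE in_itv /= andbT.
rewrite ge0_integralD//=; last 3 first.
- by move=> u _; rewrite lee_fin exprn_ge0// divr_ge0.
- by move=> u _; apply: sume_ge0 => k _; rewrite lee_fin mulr_ge0.
- by apply: emeasurable_sum => k; apply: mf.
rewrite integral_itv_cst// subr0 EFinD; congr (_ + _)%E.
rewrite ge0_integral_sum//; last 2 first.
- by move=> k; apply: mf.
- by move=> k u _; rewrite lee_fin mulr_ge0.
rewrite -sumEFin; apply: eq_bigr => k _.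
pose c := a k.+1 - a k; pose I : set (measurableTypeR R) := `]W k, +oo[%classic.
transitivity (\int[mu]_(u in itv 0 (W n)) (c%:E * (\1_I u)%:E))%E.
  by apply: eq_integral => u _; rewrite /f EFinM.
have mI : measurable I by exact: measurable_itv.
rewrite ge0_integralZl_EFin//; last 2 first.
- by apply/measurable_EFinP; exact: measurable_indic.
- exact: am.
rewrite integral_indic// EFinM; congr (_ * _)%E.
rewrite (_ : _ `&` _ = itv (W k) (W n)); last first.
  apply/seteqP; split => u; rewrite /I /= !in_itv /= andbT.
    by move=> [-> /andP[_ ->]].
  by move=> /andP[Wu uW]; rewrite Wu uW (le_lt_trans (W0 k) Wu).
by apply: lebesgue_itv_oc; apply: Wm; exact: ltnW.
Qed.


(** If a finer proper filter contained [A] while [F] missed its preimage, then [F] would contain the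
    complementary preimage, and the finer filter both [A] and its complement. *)
Lemma ultrafilter_image T U (f : T -> U) (F : set_system T) :
  UltraFilter F -> UltraFilter (f @ F).
Proof.
move=> FU; split; first exact: fmap_proper_filter.
move=> G PG sFG; apply/seteqP; split => // A GA.
have [//|FnA] := in_ultra_setVsetC (f @^-1` A) FU.
have : G (A `&` ~` A) by apply: filterI => //; exact: sFG.
by rewrite setICr => /filter_not_empty.
Qed.

(* Along an ultrafilter the [g_ n] converge pointwise.  No domination theorem
   holds for such limits, but the integral of a monotone function is within
   [S / N] of its Riemann sums with [N] terms, and these are finite sums. *)
Lemma monotone_moment_limit (S : R) (g_ : nat -> R -> R)
    (m : nat -> nat -> R) (a : nat -> R) :
  0 <= S -> (forall n, {homo g_ n : u v / u <= v}) ->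
  (forall n u, 0 <= g_ n u <= 1) ->
  (forall n j, (\int[mu]_(u in itv 0 S) (g_ n u ^+ j)%:E = (m n j)%:E)%E) ->
  (forall j, m n j @[n --> \oo] --> a j) ->
  exists g : R -> R, [/\ {homo g : u v / u <= v}, forall u, 0 <= g u <= 1 &
    forall j, (\int[mu]_(u in itv 0 S) (g u ^+ j)%:E = (a j)%:E)%E].
Proof.
move=> S0 gm g01 int_g ma.
(* As [U] refines the filter of eventual sets, ordinary limits persist along it; compactness of
   [0, 1] supplies the pointwise limits. *)
have [U [UU ooU]] := ultraFilterLemma (eventually_filter : ProperFilter \oo).
have limU u : exists l : R, g_ n u @[n --> U] --> l.
  have UI : ((fun n => g_ n u) @ U) `[0, 1]%classic.
    by apply: (@filterE _ U) => n; rewrite /= in_itv /=; exact: g01.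
  have := @segment_compact R 0 1; rewrite compact_ultra.
  by move=> /(_ _ (ultrafilter_image (fun n => g_ n u) UU) UI) [l [_ gl]]; exists l.
have [g g_cvg] := choice limU.
have gm' : {homo g : u v / u <= v}.
  by move=> u v uv; apply: ler_cvg_to (g_cvg u) (g_cvg v) _; apply: nearW => n; exact: gm.
have g01' u : 0 <= g u <= 1.
  apply/andP; split; [apply: cvgr_to_ge (g_cvg u) _|apply: cvgr_to_le (g_cvg u) _];
    by apply: nearW => n; case/andP: (g01 n u).
exists g; split => // j.
have riemann (f : R -> R) N (d := S / N.+1%:R) :
    {homo f : u v / u <= v} -> (forall u, 0 <= f u <= 1) ->
    ((d * \sum_(i < N.+1) f (i%:R * d) ^+ j)%:E
     <= \int[mu]_(x in itv 0 S) (f x ^+ j)%:E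
     <= (d * \sum_(i < N.+1) f (i.+1%:R * d) ^+ j)%:E)%E.
  move=> fm f01; have SE : S = N.+1%:R * d by rewrite mulrC divfK.
  rewrite [X in itv 0 X]SE; apply: (@monotone_riemann_sum (fun x => f x ^+ j)).
  - move=> u v uv; rewrite lerXn2r ?fm// nnegrE.
      by case/andP: (f01 u).
    by case/andP: (f01 v).
  - by move=> x; rewrite exprn_ge0//; case/andP: (f01 x).
  - by rewrite divr_ge0.
have cvg_sumU N (z : nat -> R) (d : R) :
    d * \sum_(i < N) g_ n (z i) ^+ j @[n --> U] --> d * \sum_(i < N) g (z i) ^+ j.
  apply: cvgMr; elim: N => [|N IH].
    by under eq_fun do rewrite big_ord0; rewrite big_ord0; exact: cvg_cst.
  under eq_fun do rewrite big_ord_recr; rewrite big_ord_recr.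
  apply: cvgD => //=.
  exact: cvg_comp (g_cvg (z N)) (@exprn_continuous R j (g (z N))).
have maU : m n j @[n --> U] --> a j by apply: cvg_trans (ma j); exact: cvg_app.
pose up (d : R) N := d * \sum_(i < N) g (i.+1%:R * d) ^+ j.
pose lo (d : R) N := d * \sum_(i < N) g (i%:R * d) ^+ j.
(* The Riemann bounds for [g_ n] involve finitely many values, so they pass to the limit along [U]
   and trap [a j] between the sums of [g]. *)
have squeeze N (d := S / N.+1%:R) : lo d N.+1 <= a j <= up d N.+1.
  apply/andP; split.
    apply: ler_cvg_to (cvg_sumU N.+1 (fun i => i%:R * d) d) maU _; apply: nearW => n.
    have /andP[+ _] := riemann (g_ n) N (gm n) (g01 n).
    by rewrite int_g lee_fin.
  apply: ler_cvg_to maU (cvg_sumU N.+1 (fun i => i.+1%:R * d) d) _; apply: nearW => n.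
  have /andP[_ +] := riemann (g_ n) N (gm n) (g01 n).
  by rewrite int_g lee_fin.
(* The difference telescopes to [d] times the total increase of [g ^+ j], which is at most 1. *)
have gap N (d := S / N.+1%:R) : up d N.+1 - lo d N.+1 <= d.
  rewrite /up /lo -mulrBr ler_piMr ?divr_ge0// -sumrB.
  rewrite -(big_mkord xpredT (fun i => g (i.+1%:R * d) ^+ j - g (i%:R * d) ^+ j)).
  rewrite (telescope_sumr (fun i => g (i%:R * d) ^+ j))// lerBlDr.
  have /andP[? ?] := g01' (N.+1%:R * d); have /andP[? _] := g01' (0%N%:R * d).
  by rewrite (@le_trans _ _ 1) ?exprn_ile1// lerDl exprn_ge0.
(* Finiteness follows from the bounds with a single cell. *)
have [I intE] : exists I, (\int[mu]_(u in itv 0 S) (g u ^+ j)%:E)%E = I%:E.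
  have := riemann g 0%N gm' g01' => /=; case: (\int[mu]_(u in _) _)%E => [r _||].
  - by exists r.
  - by move=> /andP[_]; rewrite leye_eq.
  - by move=> /andP[+ _]; rewrite leeNy_eq.
rewrite intE; congr (_%:E); apply/eqP; rewrite -subr_eq0 -normr_le0.
have close N : `|I - a j| <= S * N.+1%:R^-1.
  have rI : lo (S / N.+1%:R) N.+1 <= I <= up (S / N.+1%:R) N.+1.
    by have := riemann g N gm' g01'; rewrite intE !lee_fin.
  have sN : lo (S / N.+1%:R) N.+1 <= a j <= up (S / N.+1%:R) N.+1 := squeeze N.
  have gN : up (S / N.+1%:R) N.+1 - lo (S / N.+1%:R) N.+1 <= S / N.+1%:R := gap N.
  move: rI sN gN; rewrite ler_norml.
  clearbody lo up; set e := S / _; clearbody e.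
  set l := lo _ _; set u := up _ _; clearbody l u.
  move=> /andP[? ?] /andP[? ?] ?; lra.
have cvgS : S * N.+1%:R^-1 @[N --> \oo] --> 0.
  by rewrite -[X in _ --> X](mulr0 S); apply: cvgMr; exact: cvg_harmonic.
by apply: cvgr_to_ge cvgS _; exact: nearW.
Qed.

End MonotoneIntegrals.

(** * Construction of a solution *)

Section Existence.
Variables (R : realType) (s : nat -> R).
Hypothesis hS : forall T : nat, (2 <= T)%N ->
  possemidef (hankel s 0 T - hankel s 1 T) /\ posdef (hankel s 1 T).

Lemma sum_bernstein_weight n : \sum_(k < n.+1) bernstein_weight s n k = s 0%N.
Proof.
rewrite -[RHS]mul1r -(@bernstein_weight_ffact _ s n 0)//.
by apply: eq_bigr => k _; rewrite ffactn0 mulr1.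
Qed.

(** For [j <= n.+1], [s j] is exactly the weighted sum of the ratios of falling factorials.
    Replacing these by powers costs at most [j ^ 2 / n.+1] per unit of mass, and the total mass is
    [s 0]. The shift to [n.+1] avoids division by 0. *)
Lemma bernstein_moment_cvg j :
  \sum_(k < n.+2) bernstein_weight s n.+1 k * (k%:R / n.+1%:R) ^+ j
    @[n --> \oo] --> s j.
Proof.
have w0 := bernstein_weight_ge0 hS.
have s0 : 0 <= s 0%N by rewrite -(sum_bernstein_weight 0) sumr_ge0.
pose e n : R := s 0%N * (j ^ 2)%:R * n.+1%:R^-1.
have e0 : e n @[n --> \oo] --> 0.
  by rewrite -[X in _ --> X](mulr0 (s 0%N * (j ^ 2)%:R)); apply: cvgMr; exact: cvg_harmonic.
apply: (@squeeze_cvgr _ _ _ _ (fun n => s j - e n) (fun n => s j + e n)); last 2 first.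
- by rewrite -[X in _ --> X]subr0; apply: cvgB => //; exact: cvg_cst.
- by rewrite -[X in _ --> X]addr0; apply: cvgD => //; exact: cvg_cst.
near=> n; rewrite -ler_distl.
have jn : (j <= n.+1)%N by apply: leqW; near: n; exact: nbhs_infty_ge.
have -> : s j = \sum_(k < n.+2)
    bernstein_weight s n.+1 k * ((k ^_ j)%:R / (n.+1 ^_ j)%:R).
  under eq_bigr do rewrite mulrA.
  rewrite -mulr_suml bernstein_weight_ffact// mulrAC divff ?mul1r//.
  by rewrite pnatr_eq0 -lt0n ffact_gt0.
rewrite -sumrB; apply: le_trans (ler_norm_sum _ _ _) _.
rewrite /e -(sum_bernstein_weight n.+1) -mulrA mulr_suml; apply: ler_sum => k _.
rewrite -mulrBr normrM ger0_norm// ler_wpM2l// ffact_ratio_close//.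
by rewrite -ltnS.
Unshelve. all: by end_near.
Qed.

Lemma hausdorff_solution_exists :
  exists rho : {measure set (measurableTypeR R) -> \bar R}, hausdorff_solution s rho.
Proof.
have w0 := bernstein_weight_ge0 hS.
have s0 : 0 <= s 0%N by rewrite -(sum_bernstein_weight 0) sumr_ge0.
have [|||||g [gm g01 int_g]] := @monotone_moment_limit R (s 0%N)
  (fun n => quantile (bernstein_weight s n.+1) n.+1)
  (fun n j => \sum_(k < n.+2) bernstein_weight s n.+1 k * (k%:R / n.+1%:R) ^+ j) s.
- exact: s0.
- by move=> n; exact: quantile_nondecreasing.
- by move=> n u; exact: quantile_01.
- by move=> n j; rewrite -(sum_bernstein_weight n.+1) integral_quantile_expr.
- exact: bernstein_moment_cvg.
have mg : measurable_fun setT (g : measurableTypeR R -> measurableTypeR R).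
  exact: nondecreasing_measurable.
pose I : set (measurableTypeR R) := `]0, (s 0%N)]%classic.
have mI : measurable I by exact: measurable_itv.
pose lam : {measure set (measurableTypeR R) -> \bar R} :=
  mrestr (@lebesgue_measure R) mI.
unshelve (exists (pushforward lam (g : measurableTypeR R -> measurableTypeR R)));
  [exact: mg|split].
  rewrite /= /pushforward (_ : _ @^-1` _ = set0) ?measure0//.
  apply/seteqP; split => // u /=; rewrite in_itv /=; apply; exact: g01.
move=> k; rewrite -int_g.
have mk : @measurable_fun _ _ (measurableTypeR R) (\bar R) setT
    (fun x : R => (x ^+ k)%:E).
  by apply/measurable_EFinP; exact: exprn_measurable.
have ik : lam.-integrable setT (fun u => (g u ^+ k)%:E).
  apply: (@measurable_bounded_integrable _ _ R lam (fun u => g u ^+ k)) => //.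
  - by rewrite /lam /= /mrestr setTI lebesgue_itv_oc// ltry.
  - exact: (measurable_funX k mg).
  exists 1; split=> // M M1 u _ /=; have /andP[g0 g1] := g01 u.
  by rewrite normrX ger0_norm// (le_trans _ (ltW M1))// exprn_ile1.
rewrite /= (integral_pushforward mg mk ik measurableT) preimage_setT.
(* The complement of [I] is null for [lam], and inside [I] the measure [lam] agrees with Lebesgue
   measure. *)
rewrite (@negligible_integral _ _ _ lam setT (~` I))//.
- rewrite setTD setCK; apply: eq_measure_integral => A mA AI.
  by rewrite /= /lam /= /mrestr setIidl.
- exact: measurableC.
- by rewrite /lam /= /mrestr setICl measure0.
Qed.
End Existence.

Theorem proposition15 (R : realType) (s : nat -> R)
    (hS : forall T : nat, (2 <= T)%N ->
       possemidef (hankel s 0 T - hankel s 1 T) /\ posdef (hankel s 1 T)) :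
  hausdorff_determinate s.
Proof.
have [rho rho_s] := hausdorff_solution_exists hS.
by exists rho; split=> // rho' rho'_s; exact: (moments_determine rho_s rho'_s).
Qed.
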